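(* Let $H$ be a subgroup of $PL_o(I)$. Then $H$ is non-solvable if and only if $W$ embeds in $H$ (that is, $H$ has a subgroup isomorphic to $W$).
   Context: $PL_o(I)$ denotes the group, under composition, of orientation-preserving piecewise-linear homeomorphisms of the unit interval $I=[0,1]$ which admit finitely many breaks in slope. $\mathbf{N}=\{0,1,2,\ldots\}$. For groups $C$ and $T$, $C\wr T$ denotes the standard restricted wreath product $\left(\bigoplus_{t\in T}C\right)\rtimes T$, where $T$ acts on the direct sum by right multiplication on the indices. Define $W_0=\{1\}$ and $W_n=W_{n-1}\wr\mathbf{Z}$ for $n\in\mathbf{N}$, $n>0$. Define $W=\bigoplus_{n\in\mathbf{N}}W_n$ (direct sum). *)

(* Defs.v *)
From HB Require Import structures.
From mathcomp Require Import all_boot all_order all_algebra.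
From mathcomp Require Import all_classical all_reals topology normedtype.

Set Implicit Arguments.
Unset Strict Implicit.
Unset Printing Implicit Defensive.

Import Order.TTheory GRing.Theory Num.Theory.
Import numFieldNormedType.Exports.

Local Open Scope classical_set_scope.
Local Open Scope group_scope.

Section Solvable.
Variable G : groupType.

Definition subgroup (H : set G) : Prop := group_closed (mem H).

Definition generated (A : set G) : set G := smallest subgroup A.

Definition derived (H : set G) : set G :=
  generated [set z | exists x y, [/\ H x, H y & z = [~ x, y]]].

Definition solvable (H : set G) : Prop :=
  exists n, iter n derived H = [set 1].

End Solvable.

Definition embeds (K G : groupType) (H : set G) : Prop :=
  exists f : {multiplicative K -> G}, injective f /\ forall k, H (f k).

Section DirectSum.
Variables (I : Type) (G : I -> groupType).

Record dirsum := DirSum {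
  dirsum_val :> forall i, G i;
  dirsum_finite : finite_set [set i | dirsum_val i <> 1] }.

HB.instance Definition _ := gen_eqMixin dirsum.
HB.instance Definition _ := gen_choiceMixin dirsum.

Implicit Types u v w : dirsum.

Lemma dirsumP u v : (forall i, u i = v i) -> u = v.
Proof.
case: u v => [u fu] [v fv] /= uv; have {}uv := functional_extensionality_dep uv.
by subst v; congr DirSum; exact: Prop_irrelevance.
Qed.

Fact dirsum_one_subproof : finite_set [set i | (1 : G i) <> 1].
Proof. by rewrite (_ : mkset _ = set0)//; apply/seteqP; split. Qed.

Definition dirsum_one := @DirSum (fun=> 1) dirsum_one_subproof.

Fact dirsum_inv_subproof u : finite_set [set i | (u i)^-1 <> 1].
Proof.
apply: sub_finite_set (dirsum_finite u) => i /= + ui; apply.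
by rewrite ui invg1.
Qed.

Definition dirsum_inv u := @DirSum (fun i => (u i)^-1) (dirsum_inv_subproof u).

Fact dirsum_mul_subproof u v : finite_set [set i | u i * v i <> 1].
Proof.
have : finite_set ([set i | u i <> 1] `|` [set i | v i <> 1]).
  by rewrite finite_setU; split; exact: dirsum_finite.
apply: sub_finite_set => i /= uv.
have [ui|] := pselect (u i = 1); last by left.
by right; rewrite ui mul1g in uv.
Qed.

Definition dirsum_mul u v :=
  @DirSum (fun i => u i * v i) (dirsum_mul_subproof u v).

Fact dirsum_mulA : associative dirsum_mul.
Proof. by move=> u v w; apply: dirsumP => i /=; rewrite mulgA. Qed.

Fact dirsum_mul1 : left_id dirsum_one dirsum_mul.
Proof. by move=> u; apply: dirsumP => i /=; rewrite mul1g. Qed.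

Fact dirsum_1mul : right_id dirsum_one dirsum_mul.
Proof. by move=> u; apply: dirsumP => i /=; rewrite mulg1. Qed.

Fact dirsum_mulV : left_inverse dirsum_one dirsum_inv dirsum_mul.
Proof. by move=> u; apply: dirsumP => i /=; rewrite mulVg. Qed.

Fact dirsum_Vmul : right_inverse dirsum_one dirsum_inv dirsum_mul.
Proof. by move=> u; apply: dirsumP => i /=; rewrite mulgV. Qed.

HB.instance Definition _ := isGroup.Build dirsum
  dirsum_mulA dirsum_mul1 dirsum_1mul dirsum_mulV dirsum_Vmul.

End DirectSum.

Section Wreath.
Variables C T : groupType.

Let base := dirsum (fun _ : T => C).

Fact shift_subproof (t : T) (b : base) : finite_set [set s | b (s * t) <> 1].
Proof.
have := finite_image (fun s => s * t^-1) (dirsum_finite b).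
apply: sub_finite_set => s /= bst.
by exists (s * t) => //; rewrite mulgK.
Qed.

(* T acts on base on the right by multiplying indices on the right: t^-1 b t
   has at s * t the coordinate of b at s. Hence t b t^-1 is: *)
Definition shift (t : T) (b : base) : base :=
  @DirSum T (fun=> C) (fun s => b (s * t)) (shift_subproof t b).

(* (b, t) stands for the product b t in the semidirect product. *)
Record wreath := Wreath { wr_base : base; wr_top : T }.

HB.instance Definition _ := gen_eqMixin wreath.
HB.instance Definition _ := gen_choiceMixin wreath.

Implicit Types x y z : wreath.

Lemma wreathP x y :
  (forall s, wr_base x s = wr_base y s) -> wr_top x = wr_top y -> x = y.
Proof. by case: x y => [b t] [c u] /= /dirsumP -> ->. Qed.

Definition wr_one := Wreath 1 1.
Definition wr_mul x y :=
  Wreath (wr_base x * shift (wr_top x) (wr_base y)) (wr_top x * wr_top y).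
Definition wr_inv x :=
  Wreath (shift (wr_top x)^-1 (wr_base x)^-1) (wr_top x)^-1.

Fact wr_mulA : associative wr_mul.
Proof. by move=> x y z; apply: wreathP => [s|] /=; rewrite !mulgA. Qed.

Fact wr_mul1 : left_id wr_one wr_mul.
Proof. by move=> x; apply: wreathP => [s|] /=; rewrite ?mul1g ?mulg1. Qed.

Fact wr_1mul : right_id wr_one wr_mul.
Proof. by move=> x; apply: wreathP => [s|] /=; rewrite mulg1. Qed.

Fact wr_mulV : left_inverse wr_one wr_inv wr_mul.
Proof. by move=> x; apply: wreathP => [s|] /=; rewrite mulVg. Qed.

Fact wr_Vmul : right_inverse wr_one wr_inv wr_mul.
Proof. by move=> x; apply: wreathP => [s|] /=; rewrite ?mulgK mulgV. Qed.

HB.instance Definition _ := isGroup.Build wreath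
  wr_mulA wr_mul1 wr_1mul wr_mulV wr_Vmul.

End Wreath.

Section TrivialGroup.

Let mul (_ _ : unit) := tt.
Let mulA : associative mul. Proof. by []. Qed.
Let mul1 : left_id tt mul. Proof. by case. Qed.
Let mul1r : right_id tt mul. Proof. by case. Qed.
Let mulV : left_inverse tt id mul. Proof. by []. Qed.
Let mulVr : right_inverse tt id mul. Proof. by []. Qed.

HB.instance Definition _ := isGroup.Build unit mulA mul1 mul1r mulV mulVr.

End TrivialGroup.

Fixpoint W_ (n : nat) : groupType :=
  if n is m.+1 then wreath (W_ m) (Algebra.to_multiplicative int) else unit.

Definition W : groupType := dirsum W_.

Section PL.
Variable R : realType.
Local Open Scope ring_scope.

Definition I01 : Type := set_type (`[0, 1]%classic : set R).
HB.instance Definition _ := Topological.on I01.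

Implicit Types (f g : I01 -> I01) (x y t : I01).

Definition homeomorphism f : Prop :=
  exists g, [/\ cancel f g, cancel g f, continuous f & continuous g].

Definition orientation_preserving f : Prop :=
  forall x y, set_val x < set_val y -> set_val (f x) < set_val (f y).

Definition affine_on f x y : Prop :=
  exists a b : R, forall t,
    set_val x <= set_val t <= set_val y ->
    set_val (f t) = a * set_val t + b.

(* B contains all the breaks: f is affine on every closed subinterval whose
   interior avoids B. *)
Definition piecewise_linear f : Prop :=
  exists B : seq I01, forall x y,
    (forall c, c \in B -> ~~ (set_val x < set_val c < set_val y)) ->
    affine_on f x y.

Definition PL_homeo f : Prop :=
  [/\ homeomorphism f, orientation_preserving f & piecewise_linear f].

Lemma oriented_le f : orientation_preserving f ->
  forall x y, set_val x <= set_val y -> set_val (f x) <= set_val (f y).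
Proof.
move=> of_ x y; rewrite le_eqVlt => /orP[/eqP/val_inj -> //|/of_].
exact: ltW.
Qed.

Lemma oriented_inv f g : cancel g f ->
  orientation_preserving f -> orientation_preserving g.
Proof.
move=> fK of_ x y; apply: contraTT; rewrite -!leNgt => /(oriented_le of_).
by rewrite !fK.
Qed.

Lemma PL_homeo_id : PL_homeo id.
Proof.
split=> //; first by exists id; split => // x; exact: cvg_id.
by exists [::] => x y _; exists 1, 0 => t _; rewrite mul1r addr0.
Qed.

Lemma PL_homeo_comp f g : PL_homeo f -> PL_homeo g -> PL_homeo (f \o g).
Proof.
move=> [[f' [fK f'K cf cf']] of_ [Bf Pf]] [[g' [gK g'K cg cg']] og [Bg Pg]].
have og' := oriented_inv g'K og.
split.
- exists (g' \o f'); split; [exact: can_comp|exact: can_comp| |].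
  + by move=> x; apply: continuous_comp; [exact: cg|exact: cf].
  + by move=> x; apply: continuous_comp; [exact: cf'|exact: cg'].
- by move=> x y /og/of_.
exists (Bg ++ map g' Bf) => x y nB.
have [|a [b gE]] := Pg x y.
  by move=> c cB; apply: nB; rewrite mem_cat cB.
have [|a' [b' fE]] := Pf (g x) (g y).
  move=> c cB; apply/negP => /andP[/og' + /og']; rewrite !gK => xc cy.
  suff /nB : g' c \in Bg ++ map g' Bf by rewrite xc cy.
  by rewrite mem_cat map_f ?orbT.
exists (a' * a), (a' * b + b') => t /andP[xt ty] /=.
rewrite fE; last by apply/andP; split; exact: (oriented_le og).
by rewrite gE ?xt// mulrDr mulrA addrA.
Qed.

Lemma PL_homeo_inv f g : cancel f g -> cancel g f -> PL_homeo f -> PL_homeo g.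
Proof.
move=> fK gK [[g' [fK' gK' cf cg']] of_ [B Pf]].
have Eg : g' = g.
  by apply/funext => x; rewrite -{1}(gK x) fK'.
subst g'; have og := oriented_inv gK of_.
split=> //; first by exists f.
exists (map f B) => x y nB.
have [|a [b fE]] := Pf (g x) (g y).
  move=> c cB; apply/negP => /andP[/of_ + /of_]; rewrite !gK => xc cy.
  by have /nB : f c \in map f B by [rewrite map_f]; rewrite xc cy.
have gB t : set_val x <= set_val t <= set_val y ->
    set_val t = a * set_val (g t) + b.
  move=> /andP[xt ty]; rewrite -fE ?gK//.
  by apply/andP; split; exact: (oriented_le og).
have [a0|a0] := eqVneq a 0.
  exists 0, (set_val (g x)) => t tB; rewrite mul0r add0r.
  have xB : set_val x <= set_val x <= set_val y.
    by case/andP: tB => xt ty; rewrite lexx (le_trans xt ty).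
  have /val_inj -> // : set_val t = set_val x.
  by rewrite (gB t)// (gB x)// a0 !mul0r.
exists a^-1, (- (a^-1 * b)) => t /gB tE.
by rewrite tE mulrDr mulKf// addrK.
Qed.

Record PLo := PLoMk { PLo_fun :> I01 -> I01; PLo_prop : PL_homeo PLo_fun }.

HB.instance Definition _ := gen_eqMixin PLo.
HB.instance Definition _ := gen_choiceMixin PLo.

Lemma PLoP (f g : PLo) : (forall x, f x = g x) -> f = g.
Proof.
case: f g => [f Pf] [g Pg] /= /funext fg.
by subst g; congr PLoMk; exact: Prop_irrelevance.
Qed.

Definition PLo_one := PLoMk PL_homeo_id.
Definition PLo_mul (f g : PLo) :=
  PLoMk (PL_homeo_comp (PLo_prop f) (PLo_prop g)).

Fact PLo_inv_subproof (f : PLo) :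
  {g : I01 -> I01 | cancel f g /\ cancel g f}.
Proof. by apply: cid; case: f => f /= [[g []]]; exists g. Qed.

Definition PLo_inv (f : PLo) : PLo :=
  let: exist g (conj fK gK) := PLo_inv_subproof f in
  PLoMk (PL_homeo_inv fK gK (PLo_prop f)).

Fact PLo_funK (f : PLo) : cancel f (PLo_inv f).
Proof. by rewrite /PLo_inv; case: PLo_inv_subproof => g []. Qed.

Fact PLo_invK (f : PLo) : cancel (PLo_inv f) f.
Proof. by rewrite /PLo_inv; case: PLo_inv_subproof => g []. Qed.

Fact PLo_mulA : associative PLo_mul.
Proof. by move=> f g h; exact: PLoP. Qed.

Fact PLo_mul1 : left_id PLo_one PLo_mul.
Proof. by move=> f; exact: PLoP. Qed.

Fact PLo_1mul : right_id PLo_one PLo_mul.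
Proof. by move=> f; exact: PLoP. Qed.

Fact PLo_mulV : left_inverse PLo_one PLo_inv PLo_mul.
Proof. by move=> f; apply: PLoP => x; exact: PLo_funK. Qed.

Fact PLo_Vmul : right_inverse PLo_one PLo_inv PLo_mul.
Proof. by move=> f; apply: PLoP => x; exact: PLo_invK. Qed.

HB.instance Definition _ := isGroup.Build PLo
  PLo_mulA PLo_mul1 PLo_1mul PLo_mulV PLo_Vmul.

End PL.

(* Main.v *)
Require Import Defs.
From HB Require Import structures.
From mathcomp Require Import all_boot all_order all_algebra.
From mathcomp Require Import all_classical all_reals.
From mathcomp Require Import lra zify.

Set Implicit Arguments.
Unset Strict Implicit.
Unset Printing Implicit Defensive.

Import Order.TTheory GRing.Theory Num.Theory.

Local Open Scope classical_set_scope.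
Local Open Scope group_scope.

(** If [W] embeds in [H] then [H] is not solvable, because the derived length of
    [W_ n] grows with [n]: projecting the derived subgroup of a wreath product
    [C wr Z] to one coordinate gives all of [C].

    The converse rests on two facts about groups of piecewise-linear
    homeomorphisms.

    - Displacement ([displace_finite]): given finitely many closed intervals,
      each contained in a component of the support of a group [G], a single
      element of [G] moves all of them off themselves.
    - Germs ([derived_near_id]): close to a point fixed by [G], the elements of
      [G] are linear on either side, so their commutators are trivial there.

    Let [T] be a finite subset of the derived subgroup of [G]. By the second
    fact and compactness, the points moved by [T] lie in finitely many closed
    intervals contained in components of the support of [G]; by the first fact
    some [h] in [G] moves the support of [T] off itself, together with all its
    nonzero powers ([wandering]). The conjugates of the group generated by [T]
    by the powers of [h] then have pairwise disjoint supports, so that [T] and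
    [h] generate a wreath product with [Z] ([wreath_embedding]).

    Let now [H] be non-solvable. Its derived subgroup is non-solvable too, and
    induction on [n] gives a copy of [W_ n] in a finitely generated subgroup of
    [H] ([W_embeds_fg]). To obtain all of [W], place a copy of [W_ n], generated
    by elements of a finite set [T], in the derived subgroup of [H], and let [L]
    be a finite subset of this derived subgroup generating a group of large
    derived length. Some [h] in [H] moves the common support of [T] and [L] off
    itself; conjugated by [h], the set [L] has support disjoint from that of
    [T]. So the elements of [H] with support disjoint from that of [T] again
    form a non-solvable group ([W_split]), and the construction can be repeated
    inside it. This yields copies of [W_ 0], [W_ 1], ... with pairwise disjoint
    supports, and these generate their direct sum ([dirsum_embedding]). *)

(** * Subgroups and derived series *)

Section Morphisms.
Variables (K G : groupType) (f : {multiplicative K -> G}).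

Lemma multiplicative1 : f 1 = 1.
Proof. by apply: (mulIg (f 1)); rewrite -gmulfM !mul1g. Qed.

Lemma multiplicativeV x : f x^-1 = (f x)^-1.
Proof. by apply: (mulIg (f x)); rewrite -gmulfM !mulVg multiplicative1. Qed.

Lemma multiplicative_inj : (forall x, f x = 1 -> x = 1) -> injective f.
Proof.
move=> f1 x y fxy; apply/divg1_eq/f1.
by rewrite gmulfM multiplicativeV fxy mulgV.
Qed.

End Morphisms.

Section Subgroups.
Variable G : groupType.
Implicit Types (A B H : set G) (x y z : G).

Lemma subgroupP H : subgroup H <->
  [/\ H 1, forall x y, H x -> H y -> H (x * y) & forall x, H x -> H x^-1].
Proof.
split=> [Hgrp|[H1 HM HV]]; last first.
  by split=> [|x y]; rewrite !inE// => Hx Hy; apply: HM => //; exact: HV.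
have HV := group_closedV Hgrp; have HM := group_closedM Hgrp.
split=> [|x y Hx Hy|x Hx].
- by case: Hgrp; rewrite inE.
- by have := HM x y; rewrite !inE; apply.
- by have := HV x; rewrite !inE; apply.
Qed.

Lemma subgroup_comm H x y : subgroup H -> H x -> H y -> H [~ x, y].
Proof.
move=> /subgroupP[H1 HM HV] Hx Hy.
by apply: (HM); [exact: HV|apply: (HM); [exact: HV|exact: HM]].
Qed.

Lemma generated_subgroup A : subgroup (generated A).
Proof.
apply/subgroupP; split=> [B [/subgroupP[]]//|x y gx gy B AB|x gx B AB].
- by have [/subgroupP[_ + _] _] := AB; apply; [exact: gx|exact: gy].
- by have [/subgroupP[_ _ +] _] := AB; apply; exact: gx.
Qed.

Lemma sub_generated A : A `<=` generated A.
Proof. exact: sub_gen_smallest. Qed.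

Lemma generated_sub A H : subgroup H -> A `<=` H -> generated A `<=` H.
Proof. by move=> Hgrp AH; exact: smallest_sub. Qed.

Lemma generated_mono A B : A `<=` B -> generated A `<=` generated B.
Proof.
move=> AB; apply: generated_sub; first exact: generated_subgroup.
by apply: subset_trans AB _; exact: sub_generated.
Qed.

Lemma derived_subgroup A : subgroup (derived A).
Proof. exact: generated_subgroup. Qed.

Lemma derived_comm A x y : A x -> A y -> derived A [~ x, y].
Proof. by move=> Ax Ay; apply: sub_generated; exists x, y. Qed.

Lemma derived_ind A H : subgroup H ->
  (forall x y, A x -> A y -> H [~ x, y]) -> derived A `<=` H.
Proof.
by move=> Hgrp AH; apply: generated_sub => // _ [x [y [Ax Ay ->]]]; exact: AH.
Qed.

Lemma derived_mono A B : A `<=` B -> derived A `<=` derived B.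
Proof.
move=> AB; apply: derived_ind; first exact: derived_subgroup.
by move=> x y /AB Bx /AB By; exact: derived_comm.
Qed.

Lemma derived_sub H : subgroup H -> derived H `<=` H.
Proof. by move=> Hgrp; apply: derived_ind => // x y; exact: subgroup_comm. Qed.

Lemma iter_derived_subgroup n H : subgroup H -> subgroup (iter n (@derived G) H).
Proof. by case: n => // n _; exact: derived_subgroup. Qed.

Lemma iter_derived_mono n A B : A `<=` B ->
  iter n (@derived G) A `<=` iter n (@derived G) B.
Proof. by move=> AB; elim: n => //= n; exact: derived_mono. Qed.

Lemma solvable_derived H : solvable (derived H) -> solvable H.
Proof. by case=> n Hn; exists n.+1; rewrite iterSr. Qed.

Lemma iter_derived_neq1 n H : subgroup H -> ~ solvable H ->
  exists2 z, iter n (@derived G) H z & z <> 1.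
Proof.
move=> Hgrp Hns; apply: contrapT => noz; apply: Hns; exists n.
apply/seteqP; split=> [z Hz|z ->].
  by apply: contrapT => z1; apply: noz; exists z.
by have /subgroupP[] := iter_derived_subgroup n Hgrp.
Qed.

(** Each element of the n-th derived subgroup of [A] already lies in that of a
    finitely generated subgroup. *)
Lemma iter_derived_finite n A z : iter n (@derived G) A z ->
  exists2 L : seq G, [set` L] `<=` A &
    iter n (@derived G) (generated [set` L]) z.
Proof.
elim: n z => [|n IHn] z /=.
  move=> Az; exists [:: z]; first by move=> y /=; rewrite inE => /eqP ->.
  by apply: sub_generated => /=; rewrite inE.
have catL (L L' : seq G) : [set` L] `<=` A -> [set` L'] `<=` A ->
    [set` L ++ L'] `<=` A.
  by move=> LA LA' y /=; rewrite mem_cat => /orP[]; [exact: LA|exact: LA'].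
have monoL k (L1 L2 : seq G) : {subset L1 <= L2} ->
    iter k (@derived G) (generated [set` L1]) `<=`
    iter k (@derived G) (generated [set` L2]).
  move=> L12; apply: iter_derived_mono; apply: generated_mono => y /=.
  exact: L12.
have subl (L L' : seq G) : {subset L <= L ++ L'}.
  by move=> y; rewrite mem_cat => ->.
have subr (L L' : seq G) : {subset L' <= L ++ L'}.
  by move=> y; rewrite mem_cat => ->; rewrite orbT.
apply: (@derived_ind _ [set z | exists2 L : seq G, [set` L] `<=` A &
    derived (iter n (@derived G) (generated [set` L])) z]).
  apply/subgroupP; split=> [|x y [L LA Lx] [L' LA' Ly]|x [L LA Lx]].
  - by exists [::] => //; have /subgroupP[] :=
      derived_subgroup (iter n (@derived G) (generated [set` [::]])).
  - exists (L ++ L'); first exact: catL.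
    have /subgroupP[_ + _] :=
      derived_subgroup (iter n (@derived G) (generated [set` L ++ L'])).
    by apply; [exact: (monoL n.+1 _ _ (subl L L'))
              |exact: (monoL n.+1 _ _ (subr L L'))].
  - exists L => //; have /subgroupP[_ _] :=
      derived_subgroup (iter n (@derived G) (generated [set` L])).
    exact.
move=> x y /IHn[L LA Lx] /IHn[L' LA' Ly]; exists (L ++ L'); first exact: catL.
by apply: derived_comm; [exact: (monoL n _ _ (subl L L'))
                        |exact: (monoL n _ _ (subr L L'))].
Qed.

Lemma derived_finite A (T : seq G) : [set` T] `<=` derived A ->
  exists2 S : seq G, [set` S] `<=` A & [set` T] `<=` derived (generated [set` S]).
Proof.
elim: T => [|t T IHT] TA; first by exists [::].
have [|S SA TS] := IHT; first by move=> y yT; apply: TA; rewrite /= inE yT orbT.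
have /(@iter_derived_finite 1)[L LA /= tL] : derived A t.
  by apply: TA; rewrite /= inE eqxx.
exists (S ++ L) => [y /=|y /=].
  by rewrite mem_cat => /orP[]; [exact: SA|exact: LA].
rewrite inE => /orP[/eqP ->|/TS]; [move: tL|];
  apply: derived_mono; apply: generated_mono => z /=; rewrite mem_cat => ->//.
by rewrite orbT.
Qed.

End Subgroups.

(** Derived series lift through a map [p] which is only required to be
    multiplicative on a subgroup [P]. *)
Lemma iter_derived_lift (K G : groupType) (P : set K) (p : K -> G) (A : set K)
    (B : set G) n :
  subgroup P -> (forall x y, P x -> P y -> p (x * y) = p x * p y) ->
  (forall b, B b -> exists2 a, A a /\ P a & p a = b) ->
  forall b, iter n (@derived G) B b ->
    exists2 a, iter n (@derived K) A a /\ P a & p a = b.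
Proof.
move=> Pgrp pM AB; have /subgroupP[P1 PM PV] := Pgrp.
have p1 : p 1 = 1.
  by apply: (mulIg (p 1)); rewrite -pM// !mul1g.
have pV x : P x -> p x^-1 = (p x)^-1.
  move=> Px; apply: (mulIg (p x)); rewrite -pM//; last exact: PV.
  by rewrite !mulVg.
elim: n => //= n IHn.
set An := iter n _ A in IHn *; set Bn := iter n _ B in IHn *.
have /subgroupP[D1 DM DV] := derived_subgroup An.
apply: (@derived_ind _ _ [set b | exists2 a, derived An a /\ P a & p a = b]).
  apply/subgroupP; split=> [|_ _ [x [Ax Px] <-] [y [Ay Py] <-]|_ [x [Ax Px] <-]].
  - by exists 1.
  - by exists (x * y); [split; [exact: DM|exact: PM]|exact: pM].
  - by exists x^-1; [split; [exact: DV|exact: PV]|exact: pV].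
move=> _ _ /IHn[x [Ax Px] <-] /IHn[y [Ay Py] <-]; exists [~ x, y].
  by split; [exact: derived_comm|exact: subgroup_comm].
have [PVx PVy Pxy] := And3 (PV x Px) (PV y Py) (PM x y Px Py).
by rewrite /commg /conjg pM ?pM ?pV//; exact: PM.
Qed.

Lemma iter_derived_morph (K G : groupType) (f : {multiplicative K -> G})
    (A : set K) (B : set G) n :
  (forall a, A a -> B (f a)) ->
  forall a, iter n (@derived K) A a -> iter n (@derived G) B (f a).
Proof.
move=> AB; elim: n => //= n IHn a Aa.
have /subgroupP[D1 DM DV] := derived_subgroup (iter n (@derived G) B).
move: a Aa; pose D := derived (iter n (@derived G) B).
apply: (@derived_ind _ _ [set a | D (f a)]).
  apply/subgroupP; split=> [|x y|x] /=.
  - by rewrite multiplicative1.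
  - by rewrite gmulfM; exact: DM.
  - by rewrite multiplicativeV; exact: DV.
move=> x y Ax Ay /=; rewrite !(gmulfM, multiplicativeV).
by apply: derived_comm; exact: IHn.
Qed.

(** * Non-solvability of the direct sum of iterated wreath products *)

(** The infinite cyclic group, in multiplicative notation. *)
Notation Zmult := (Algebra.to_multiplicative int).

(** The derived length of [W_ n.+1] exceeds [n]: on the elements with trivial top
    component, the coordinate at the identity of [Zmult] is multiplicative, and
    it maps the derived subgroup of [W_ n.+2] onto [W_ n.+1]. *)
Lemma W_derived_neq1 n : exists2 z, iter n (@derived _) [set: W_ n.+1] z & z <> 1.
Proof.
elim: n => [|n [z Dz z1]].
  by exists (@Wreath (W_ 0) Zmult 1 (1%R : int)) => // /(congr1 (@wr_top _ _)).
pose P : set (W_ n.+2) := [set x | wr_top x = 1].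
pose p (x : W_ n.+2) : W_ n.+1 := wr_base x (1 : Zmult).
have Pgrp : subgroup P.
  apply/subgroupP; split=> [//|x y|x] /=; rewrite /P /=.
  - by move=> -> ->; rewrite mulg1.
  - by move=> ->; rewrite invg1.
have pM x y : P x -> P y -> p (x * y) = p x * p y.
  by rewrite /P /p /= => -> _; rewrite mul1g.
have [a [Da _] az] : exists2 a, iter n (@derived _) (derived [set: W_ n.+2]) a
    /\ P a & p a = z.
  apply: (iter_derived_lift Pgrp pM _ Dz) => b _.
  (* Let x have b^-1 as its only coordinate, at the index 1 : Zmult, and let y
     be a generator of the top group. Then [x, y] has coordinate b at this
     index, since x ^ y is supported at another one. *)
  have bfin : finite_set [set i : Zmult |
      (if i == 1 then b^-1 else 1) <> 1].
    by apply: sub_finite_set (finite_set1 1) => i /=; case: eqP.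
  pose x : W_ n.+2 := Wreath (DirSum bfin) 1.
  pose y : W_ n.+2 := @Wreath (W_ n.+1) Zmult 1 (1%R : int).
  exists [~ x, y]; first split.
  - exact: derived_comm.
  - by [].
  - by rewrite /p /= !gsimp.
exists a; first by rewrite iterSr.
by move=> a1; apply: z1; rewrite -az a1.
Qed.

Lemma W_not_solvable : ~ solvable [set: W].
Proof.
case=> n Wn; have [z Dz z1] := W_derived_neq1 n.
have [u [Du _] uz] : exists2 u, iter n (@derived _) [set: W] u /\ setT u &
    u n.+1 = z.
  apply: (@iter_derived_lift W (W_ n.+1) setT (fun u => u n.+1) _ _ _ _ _ _ _ Dz).
  - by apply/subgroupP.
  - by [].
  - move=> b _.
    have bfin : finite_set [set i | dfwith (fun i => 1 : W_ i) n.+1 b i <> 1].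
      by apply: sub_finite_set (finite_set1 n.+1) => i /=; case: dfwithP.
    by exists (DirSum bfin) => //=; rewrite dfwithin.
by move: Du; rewrite Wn => /= u1; apply: z1; rewrite -uz u1.
Qed.

Lemma embeds_W_not_solvable (G : groupType) (H : set G) :
  embeds W H -> ~ solvable H.
Proof.
move=> [f [finj fH]] [n Hn]; apply: W_not_solvable; exists n.
apply/seteqP; split=> [w Dw|w -> /=]; last first.
  by have /subgroupP[] : subgroup (iter n (@derived _) [set: W])
    by apply: iter_derived_subgroup; apply/subgroupP.
apply: finj; rewrite multiplicative1.
have : iter n (@derived _) H (f w) by apply: iter_derived_morph Dw => a _.
by rewrite Hn.
Qed.

(** * Displacing finitely many points *)

Section Displacement.
Variable R : realType.
Implicit Types (f g h k : PLo R) (x y c d : I01 R) (G : set (PLo R)).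
Local Notation "x <i y" := (Order.lt (set_val x) (set_val y)) (at level 70).
Local Notation "x <=i y" := (Order.le (set_val x) (set_val y)) (at level 70).

Lemma PLo_lt f x y : (f x <i f y) = (x <i y).
Proof.
have [_ of_ _] := PLo_prop f.
apply/idP/idP; last exact: of_.
by apply: contraTT; rewrite -!leNgt; exact: (oriented_le of_).
Qed.

Lemma PLo_le f x y : (f x <=i f y) = (x <=i y).
Proof. by rewrite !leNgt PLo_lt. Qed.

Lemma PLoK f x : f^-1 (f x) = x. Proof. exact: PLo_funK. Qed.

Lemma PLoVK f x : f (f^-1 x) = x. Proof. exact: PLo_invK. Qed.

(** Some element of [G] carries [c] beyond [d]. For [c <= d] this means that
    the interval [c, d] lies in one component of the support of [G]. *)
Definition reach G c d := exists2 g, G g & d <i g c.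

(** [h] moves the interval [c, d] off itself. *)
Definition displaces h c d := (d <i h c \/ h d <i c).

Section Reach.
Variable G : set (PLo R).
Hypothesis Gsub : subgroup G.

Let GM g h : G g -> G h -> G (g * h).
Proof. by case/subgroupP: Gsub => _ + _; apply. Qed.

Let GV g : G g -> G g^-1.
Proof. by case/subgroupP: Gsub => _ _; apply. Qed.

Lemma reach_le c d c' d' : c <=i c' -> d' <=i d ->
  reach G c d -> reach G c' d'.
Proof.
move=> cc dd [g Gg dgc]; exists g => //.
by rewrite (le_lt_trans dd)// (lt_le_trans dgc)// PLo_le.
Qed.

Lemma reach_trans c x d : reach G c x -> reach G x d -> reach G c d.
Proof.
move=> [g Gg xgc] [h Gh dhx]; exists (h * g); first exact: GM.
by apply: lt_trans dhx _; rewrite PLo_lt.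
Qed.

Lemma reach_actl k c d : G k -> reach G c d -> reach G (k c) d.
Proof.
move=> Gk [g Gg dgc]; exists (g * k^-1); first by apply: GM => //; exact: GV.
by rewrite /= PLoK.
Qed.

Lemma reach_actr k c d : G k -> reach G c d -> reach G c (k d).
Proof.
move=> Gk [g Gg dgc]; exists (k * g); first exact: GM.
by rewrite /= PLo_lt.
Qed.

Let below2 (P : I01 R -> Prop) x y : P x -> P y ->
  exists2 z, P z & (z <=i x /\ z <=i y).
Proof. by case/orP: (le_total (set_val x) (set_val y)) => ?; [exists x|exists y]. Qed.

Let above2 (P : I01 R -> Prop) x y : P x -> P y ->
  exists2 z, P z & (x <=i z /\ y <=i z).
Proof. by case/orP: (le_total (set_val x) (set_val y)) => ?; [exists y|exists x]. Qed.

(** A bigger interval in the same component absorbs the images of [c, d] under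
    [g] and its inverse. *)
Lemma reach_enlarge g c d : G g -> c <=i d -> reach G c d ->
  exists c' d', [/\ c' <=i d', reach G c' d',
    [/\ c' <=i c, c' <=i g c & c' <=i g^-1 c] &
    [/\ d <=i d', g d <=i d' & g^-1 d <=i d']].
Proof.
move=> Gg cd rcd; have GVg := GV Gg.
have [a ra [ac agc]] : exists2 z, reach G z d & (z <=i c /\ z <=i g c).
  by apply: (below2 (P := fun z => reach G z d)) => //; exact: reach_actl.
have [c' rc' [c'a c'gc]] :
    exists2 z, reach G z d & (z <=i a /\ z <=i g^-1 c).
  by apply: (below2 (P := fun z => reach G z d)) => //; exact: reach_actl.
have [b rb [db gdb]] : exists2 z, reach G c' z & (d <=i z /\ g d <=i z).
  by apply: (above2 (P := fun z => reach G c' z)) => //; exact: reach_actr.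
have [d' rd' [bd' gdd']] :
    exists2 z, reach G c' z & (b <=i z /\ g^-1 d <=i z).
  by apply: (above2 (P := fun z => reach G c' z)) => //; exact: reach_actr.
exists c', d'; split=> //.
- by rewrite (le_trans c'a)// (le_trans ac)// (le_trans cd)// (le_trans db).
- by split; [exact: le_trans c'a ac|exact: le_trans c'a agc|].
- by split=> //; [exact: le_trans db bd'|exact: le_trans gdb bd'].
Qed.

(** Finitely many intervals, each inside a component of the support of [G], can
    be moved off themselves by a single element of [G]. *)
Lemma displace_finite (L : seq (I01 R * I01 R)) :
  exists2 h, G h & forall p, p \in L -> p.1 <=i p.2 ->
    reach G p.1 p.2 -> displaces h p.1 p.2.
Proof.
move En: (size L) => n; elim: n L En => [|n IHn] [|[c d] L] //= => [_|[sL]].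
  by exists 1 => //; case/subgroupP: Gsub.
have [[cd rcd]|nval] := pselect (c <=i d /\ reach G c d); last first.
  have [h Gh hL] := IHn L sL; exists h => // p; rewrite inE => /orP[/eqP -> /=|].
    by move=> cd rcd; case: nval.
  exact: hL.
have [g Gg dgc] := rcd; have GVg := GV Gg.
have /choice[E EP] : forall p : I01 R * I01 R, exists q : I01 R * I01 R,
    p.1 <=i p.2 -> reach G p.1 p.2 -> [/\ q.1 <=i q.2, reach G q.1 q.2,
    [/\ q.1 <=i p.1, q.1 <=i g p.1 & q.1 <=i g^-1 p.1] &
    [/\ p.2 <=i q.2, g p.2 <=i q.2 & g^-1 p.2 <=i q.2]].
  move=> [a b]; have [[ab rab]|nab] := pselect (a <=i b /\ reach G a b).
    by have [a' [b' ?]] := reach_enlarge Gg ab rab; exists (a', b').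
  by exists (a, b) => ab rab; case: nab.
have [|h Gh hE] := IHn (map E L); first by rewrite size_map.
(* Each of h, g h, g^-1 h and h g moves the intervals of L off themselves, and
   one of them does so for [c, d], according to the position of h [c, d]. *)
suff [k [Gk kcd kL]] : exists k, [/\ G k, displaces k c d & k \in
    [:: h; g * h; g^-1 * h; h * g]].
  exists k => // p; rewrite inE => /orP[/eqP -> //|pL] ple rp.
  have [qle rq [q1 q2 q3] [q4 q5 q6]] := EP p ple rp.
  have := hE (E p) (map_f E pL) qle rq.
  move: kL; rewrite /displaces !inE => /or4P[] /eqP -> /= [hq|hq].
  - by left; rewrite (le_lt_trans q4)// (lt_le_trans hq)// PLo_le.
  - by right; rewrite (lt_le_trans _ q1)// (le_lt_trans _ hq)// PLo_le.
  - left; rewrite -(PLo_lt g^-1) PLoK (le_lt_trans q6)// (lt_le_trans hq)//.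
    by rewrite PLo_le.
  - right; rewrite -(PLo_lt g^-1) PLoK (lt_le_trans _ q3)// (le_lt_trans _ hq)//.
    by rewrite PLo_le.
  - left; rewrite -(PLo_lt g) PLoVK (le_lt_trans q5)// (lt_le_trans hq)//.
    by rewrite PLo_le.
  - right; rewrite -(PLo_lt g) PLoVK (lt_le_trans _ q2)// (le_lt_trans _ hq)//.
    by rewrite PLo_le.
  - by left; rewrite (le_lt_trans q4)// (lt_le_trans hq)// PLo_le.
  - by right; rewrite (lt_le_trans _ q1)// (le_lt_trans _ hq)// PLo_le.
rewrite /displaces; have [chc|hcc] := leP (set_val c) (set_val (h c)).
  exists (g * h); split; [exact: GM| |by rewrite !inE eqxx orbT].
  by left; rewrite (lt_le_trans dgc)//= PLo_le.
have [hdd|dhd] := leP (set_val (h d)) (set_val d).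
  exists (g^-1 * h); split; [exact: GM| |by rewrite !inE eqxx !orbT].
  by right; rewrite -(PLo_lt g) /= PLoVK (le_lt_trans hdd).
exists (h * g); split; [exact: GM| |by rewrite !inE eqxx !orbT].
by left; rewrite (lt_trans dhd)//= PLo_lt.
Qed.

End Reach.
End Displacement.

(** * Wandering supports *)

Section Wandering.
Variable R : realType.
Implicit Types (f g h k : PLo R) (t x y z c d : I01 R) (G : set (PLo R)).
Local Notation "x <i y" := (Order.lt (set_val x) (set_val y)) (at level 70).
Local Notation "x <=i y" := (Order.le (set_val x) (set_val y)) (at level 70).

Lemma I01_ge0 x : (0 <= set_val x)%R.
Proof. by have := set_valP x; rewrite /= in_itv /= => /andP[]. Qed.

Lemma I01_le1 x : (set_val x <= 1)%R.
Proof. by have := set_valP x; rewrite /= in_itv /= => /andP[]. Qed.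

Lemma I01_point (r : R) : (0 <= r <= 1)%R -> exists x : I01 R, set_val x = r.
Proof.
move=> r01; have rI : r \in (`[0, 1]%classic : set R)%R.
  by rewrite inE /= in_itv.
by exists (SigSub rI).
Qed.

Lemma I01_between x z : x <i z -> exists y, x <i y /\ y <i z.
Proof.
move=> xz; have := I01_ge0 x; have := I01_le1 z => z1 x0.
have [|y yE] := @I01_point ((set_val x + set_val z) / 2)%R.
  by apply/andP; split; lra.
by exists y; rewrite yE; split; lra.
Qed.

Lemma seq_isolated (B : seq (I01 R)) y : exists2 e : R, (0 < e)%R &
  forall c, c \in B -> c != y -> (e <= `|set_val c - set_val y|)%R.
Proof.
elim: B => [|c B [e e0 eB]]; first by exists 1%R.
have [->|cy] := eqVneq c y.
  exists e => // c'; rewrite inE => /orP[/eqP ->|]; first by rewrite eqxx.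
  exact: eB.
have cy0 : (0 < `|set_val c - set_val y|)%R.
  by rewrite normr_gt0 subr_eq0; apply: contraNneq cy => /val_inj ->.
exists (Num.min e `|set_val c - set_val y|)%R; first by rewrite lt_min e0.
move=> c'; rewrite inE => /orP[/eqP -> _|/eB + c'y]; first by rewrite ge_min lexx orbT.
by move=> /(_ c'y); rewrite ge_min => ->.
Qed.

(** At a fixed point, a piecewise linear homeomorphism is linear on either side,
    the side being given by the sign [s]. *)
Lemma PLo_germ f y (s : R) : f y = y -> (s = 1 \/ s = -1)%R ->
  exists2 e : R, (0 < e)%R & exists a : R, forall t,
    (0 <= s * (set_val t - set_val y) <= e)%R ->
    set_val (f t) = (set_val y + a * (set_val t - set_val y))%R.
Proof.
move=> fy s1; have [_ _ [B Bf]] := PLo_prop f.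
have [e e0 eB] := seq_isolated B y; exists e => //.
have y0 := I01_ge0 y; have y1 := I01_le1 y.
have key (u w : I01 R) : (set_val w - set_val u <= e)%R -> u = y \/ w = y ->
    u <=i y -> y <=i w -> exists a : R, forall t, u <=i t -> t <=i w ->
    set_val (f t) = (set_val y + a * (set_val t - set_val y))%R.
  move=> uwe uwy uy yw; have [|a [b ab]] := Bf u w.
    move=> c cB; apply/negP => /andP[uc cw].
    have cy : c != y.
      by apply/eqP => cy; move: uc cw; rewrite cy; case: uwy => ->; rewrite ltxx.
    have := eB c cB cy; rewrite leNgt => /negP; apply.
    rewrite ltr_norml; move: uc cw uwe.
    by case: uwy => -> *; apply/andP; split; lra.
  exists a => t ut tw; have := ab y; rewrite fy uy yw => /(_ isT).
  by have := ab t; rewrite ut tw => /(_ isT) -> ?; lra.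
case: s1 => ->.
- have [|w wE] := @I01_point (Num.min 1 (set_val y + e))%R.
    by have [] := leP 1%R (set_val y + e)%R => ?; apply/andP; split; lra.
  have [||||a aP] := @key y w; [| by left|by []| |].
  + by rewrite wE; have [] := leP 1%R (set_val y + e)%R => ?; lra.
  + by rewrite wE; have [] := leP 1%R (set_val y + e)%R => ?; lra.
  exists a => t /andP[yt te]; have t1 := I01_le1 t; apply: aP; first lra.
  by rewrite wE; have [] := leP 1%R (set_val y + e)%R => ?; lra.
- have [|u uE] := @I01_point (Num.max 0 (set_val y - e))%R.
    by have [] := leP 0%R (set_val y - e)%R => ?; apply/andP; split; lra.
  have [||||a aP] := @key u y; [| by right| |by []|].
  + by rewrite uE; have [] := leP 0%R (set_val y - e)%R => ?; lra.
  + by rewrite uE; have [] := leP 0%R (set_val y - e)%R => ?; lra.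
  exists a => t /andP[yt te]; have t0 := I01_ge0 t; apply: aP; last lra.
  by rewrite uE; have [] := leP 0%R (set_val y - e)%R => ?; lra.
Qed.

(** Two elements fixing [y] commute close to [y], since they are linear on
    either side of [y]. *)
Lemma PLo_commute_side f g y (s : R) : f y = y -> g y = y ->
  (s = 1 \/ s = -1)%R ->
  exists2 e : R, (0 < e)%R & forall t,
    (0 <= s * (set_val t - set_val y) <= e)%R -> f (g t) = g (f t).
Proof.
move=> fy gy s1; have [e e0 [a aP]] := PLo_germ fy s1.
have [e' e'0 [a' a'P]] := PLo_germ gy s1.
have side h t : h y = y -> (0 <= s * (set_val t - set_val y))%R ->
    (0 <= s * (set_val (h t) - set_val y))%R.
  move=> hy; case: s1 => ->; rewrite ?mul1r ?mulN1r ?oppr_ge0 ?subr_le0 ?subr_ge0.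
    by rewrite -{2}hy PLo_le.
  by rewrite -{2}hy PLo_le.
have small (b r : R) : (0 < r)%R -> exists2 d : R, (0 < d)%R &
    forall u : R, (0 <= u <= d)%R -> (b * u <= r)%R.
  move=> r0; exists (r / (`|b| + 1))%R; first by rewrite divr_gt0// ltr_wpDl.
  move=> u /andP[u0 ud]; apply: (@le_trans _ _ ((`|b| + 1) * u)%R).
    by rewrite ler_wpM2r// (le_trans (ler_norm b))// lerDl.
  by rewrite mulrC -ler_pdivlMr// ltr_wpDl.
have [d d0 dP] := small a e' e'0; have [d' d'0 d'P] := small a' e e0.
exists (Num.min (Num.min e e') (Num.min d d')); first by rewrite !lt_min e0 e'0 d0.
move=> t /andP[t0]; rewrite !le_min => /andP[/andP[te te'] /andP[td td']].
have ft := aP t; rewrite t0 te in ft; have {}ft := ft isT.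
have gt := a'P t; rewrite t0 te' in gt; have {}gt := gt isT.
apply: val_inj.
have -> : val (f (g t)) = (set_val y + a * (set_val (g t) - set_val y))%R.
  apply: aP; rewrite side//= gt addrAC subrr add0r mulrCA.
  by apply: d'P; rewrite t0.
have -> : val (g (f t)) = (set_val y + a' * (set_val (f t) - set_val y))%R.
  apply: a'P; rewrite side//= ft addrAC subrr add0r mulrCA.
  by apply: dP; rewrite t0.
by rewrite ft gt; lra.
Qed.

Lemma PLo_commute_near f g y : f y = y -> g y = y ->
  exists2 e : R, (0 < e)%R & forall t,
    (`|set_val t - set_val y| < e)%R -> f (g t) = g (f t).
Proof.
move=> fy gy; have [e e0 eP] := PLo_commute_side fy gy (or_introl erefl).
have [e' e'0 e'P] := PLo_commute_side fy gy (or_intror erefl).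
exists (Num.min e e'); first by rewrite lt_min e0.
move=> t; rewrite lt_min !ltr_norml => /andP[/andP[? ?] /andP[? ?]].
have [yt|ty] := leP (set_val y) (set_val t); first by apply: eP; lra.
by apply: e'P; lra.
Qed.

(** Near a common fixed point of [G], the elements of the derived subgroup of
    [G] are trivial. *)
Lemma derived_near_id G y h : (forall g, G g -> g y = y) -> derived G h ->
  exists2 e : R, (0 < e)%R & forall t,
    (`|set_val t - set_val y| < e)%R -> h t = t.
Proof.
move=> Gy; pose H : set (PLo R) := [set h | exists2 e : R, (0 < e)%R &
  forall t, (`|set_val t - set_val y| < e)%R -> h t = t].
suff sub : derived G `<=` H by exact: sub.
move=> {h}.
apply: derived_ind.
  apply/subgroupP; split=> [|g h [e e0 eP] [e' e'0 e'P]|h [e e0 eP]].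
  - by exists 1%R.
  - exists (Num.min e e'); first by rewrite lt_min e0.
    by move=> t; rewrite lt_min => /andP[te te'] /=; rewrite e'P// eP.
  - by exists e => // t te; rewrite -{1}(eP t te) PLoK.
move=> g h Gg Gh; have [e e0 eP] := PLo_commute_near (Gy g Gg) (Gy h Gh).
by exists e => // t te /=; rewrite eP// !PLoK.
Qed.

(** The points moved by some element of [T]. *)
Definition moved (T : set (PLo R)) : set (I01 R) :=
  [set x | exists2 g, T g & g x <> x].

Lemma derived_near_id_seq G (T : seq (PLo R)) y : (forall g, G g -> g y = y) ->
  [set` T] `<=` derived G ->
  exists2 e : R, (0 < e)%R & forall t,
    (`|set_val t - set_val y| < e)%R -> ~ moved [set` T] t.
Proof.
move=> Gy; elim: T => [_|h T IHT TG].
  by exists 1%R => // t _ [g].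
have [|e e0 eP] := IHT; first by move=> g gT; apply: TG; rewrite /= inE gT orbT.
have [|e' e'0 e'P] := derived_near_id Gy (_ : derived G h).
  by apply: TG; rewrite /= inE eqxx.
exists (Num.min e e'); first by rewrite lt_min e0.
move=> t; rewrite lt_min => /andP[te te'] [g /=].
rewrite inE => /orP[/eqP ->|gT gt]; first by rewrite e'P.
by apply: (eP t te); exists g.
Qed.

Section Cover.
Variables (G : set (PLo R)) (T : seq (PLo R)).
Hypotheses (Gsub : subgroup G) (TG : [set` T] `<=` derived G).

(** The points of [X] moved by [T] lie in finitely many intervals [c, d], with
    end points in [P], each inside a component of the support of [G]. *)
Let covers (P : seq (I01 R)) (X : set (I01 R)) :=
  forall x, moved [set` T] x -> X x -> exists c d,
    [/\ c \in P, d \in P, c <=i x, x <=i d & reach G c d].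

(* If y is fixed by G, no point close to y is moved by T. Otherwise, y lies in
   the interior of an interval that some element of G moves off itself. *)
Let cover_local y : exists2 e : R, (0 < e)%R & exists P,
  covers P [set x | (`|set_val x - set_val y| < e)%R].
Proof.
have [Gy|/existsNP[g /not_implyP[Gg gy]]] :=
  pselect (forall g, G g -> g y = y).
  have [e e0 eP] := derived_near_id_seq Gy TG.
  by exists e => //; exists [::] => x xT /eP.
have [k Gk yky] : exists2 k, G k & y <i k y.
  have [ygy|gyy|/val_inj/esym//] := ltgtP (set_val y) (set_val (g y)).
    by exists g.
  exists g^-1; first by have /subgroupP[_ _] := Gsub; apply.
  by rewrite -(PLo_lt g) PLoVK.
have [d' [yd' d'ky]] := I01_between yky.
have [d [yd dd']] := I01_between yd'.
pose c := k^-1 d'; have kc : k c = d' by exact: PLoVK.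
have cy : c <i y by rewrite -(PLo_lt k) kc.
exists (Num.min (set_val d - set_val y) (set_val y - set_val c))%R.
  by rewrite lt_min !subr_gt0 yd cy.
exists [:: c; d] => x _ /=; rewrite lt_min !ltr_norml => xy.
exists c, d; rewrite !inE !eqxx orbT; split=> //; [lra|lra|].
by exists k => //; rewrite kc.
Qed.

(** Compactness of the unit interval: with [A] the set of all [r] such that the
    moved points up to [r] are covered, a local cover at [sup A] shows that
    [sup A] is 1 and belongs to [A]. *)
Lemma moved_cover : exists P, covers P setT.
Proof.
pose A : set R := [set r | (0 <= r <= 1)%R /\
  exists P, covers P [set x | (set_val x <= r)%R]].
have A0 : A 0%R.
  split; first by rewrite lexx ler01.
  have [z zE] := @I01_point 0%R (introT andP (conj (lexx _) ler01)).
  have [e e0 [P PP]] := cover_local z; exists P => x xT /= x0.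
  apply: PP => //=; have := I01_ge0 x => x0'.
  by rewrite zE (_ : set_val x = 0%R) ?subrr ?normr0//; lra.
have supA : has_sup A.
  by split; [exists 0%R|exists 1%R => r [/andP[]]].
have s0 : (0 <= sup A)%R by apply: sup_upper_bound.
have s1 : (sup A <= 1)%R by apply: ge_sup; [exists 0%R|move=> r [/andP[]]].
have [y yE] := I01_point (introT andP (conj s0 s1)).
have [e e0 [P PP]] := cover_local y.
have [r [r01 [P' P'P]] rs] := sup_adherent e0 supA.
pose r' := Num.min 1%R (sup A + e / 2)%R.
have cov : covers (P ++ P') [set x | (set_val x <= r')%R].
  move=> x xT /= xr'; have [xr|rx] := leP (set_val x) r.
    have [c [d [cP dP]]] := P'P x xT xr.
    by exists c, d; rewrite !mem_cat cP dP !orbT.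
  have [|c [d [cP dP]]] := PP x xT.
    rewrite /= yE ltr_norml; move: xr'; rewrite /r' le_min => /andP[_ ?].
    by apply/andP; split; lra.
  by exists c, d; rewrite !mem_cat cP dP.
have Ar' : A r'.
  split; last by exists (P ++ P').
  by rewrite /r'; have [] := leP 1%R (sup A + e / 2)%R => ?; apply/andP; split; lra.
have := sup_upper_bound supA Ar'; rewrite /r'.
have [r'E _|] := leP 1%R (sup A + e / 2)%R; last by lra.
exists (P ++ P') => x xT _; apply: cov => //=.
by rewrite /r' min_l// I01_le1.
Qed.

(** Some element of [G] moves the support of [T] off itself, and so do all its
    positive powers. *)
Lemma wandering : exists2 h, G h & forall n x,
  moved [set` T] x -> ~ moved [set` T] (iter n.+1 h x).
Proof.
have [P covP] := moved_cover; have /subgroupP[_ GM GV] := Gsub.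
have [h Gh hP] := displace_finite Gsub [seq (c, d) | c <- P, d <- P].
exists h => // n x xT.
set y := iter _ h x => yT.
have [k Gk ky] : exists2 k, G k & k x = y.
  rewrite /y; elim: n.+1 => [|m [k Gk kx]]; first by exists 1; have /subgroupP[] := Gsub.
  by exists (h * k); [exact: GM|rewrite /= kx].
have [c1 [d1 [c1P d1P c1x xd1 r1]]] := covP x xT I.
have [c2 [d2 [c2P d2P c2y yd2 r2]]] := covP y yT I.
(* The two intervals are in the same component, hence so is their hull. *)
have [c [cP cx cy rc]] : exists c, [/\ c \in P, c <=i x, c <=i y & reach G c x].
  have [c12|/ltW c21] := leP (set_val c1) (set_val c2).
    exists c1; split=> //; first exact: le_trans c2y.
    exact: reach_le r1.
  exists c2; split=> //; first exact: le_trans c1x.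
  rewrite -(PLoK k x) ky; apply: reach_actr (GV _ Gk) _ => //.
  exact: reach_le r2.
have [d [dP xd yd rd]] : exists d, [/\ d \in P, x <=i d, y <=i d & reach G x d].
  have [d12|/ltW d21] := leP (set_val d1) (set_val d2).
    exists d2; split=> //; first exact: le_trans d12.
    rewrite -(PLoK k x) ky; apply: reach_actl (GV _ Gk) _ => //.
    exact: reach_le r2.
  exists d1; split=> //; first exact: le_trans d21.
  exact: reach_le r1.
have := hP (c, d); rewrite /= allpairs_f// => /(_ isT (le_trans cx xd)).
case/(_ (reach_trans Gsub rc rd)) => [dhc|hdc].
  have : d <i y.
    rewrite /y; elim: n {y yT yd yd2 c2y ky cy} => [|n IHn] /=.
      by rewrite (lt_le_trans dhc)// PLo_le.
    by rewrite (lt_le_trans dhc)// PLo_le (le_trans cx)// (le_trans xd)// ltW.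
  by rewrite ltNge yd.
have : y <i c.
  rewrite /y; elim: n {y yT yd yd2 c2y ky cy} => [|n IHn] /=.
    by rewrite (le_lt_trans _ hdc)// PLo_le.
  by rewrite (le_lt_trans _ hdc)// PLo_le (le_trans _ xd)// (le_trans _ cx)// ltW.
by rewrite ltNge cy.
Qed.

End Cover.
End Wandering.

(** * Embedding direct sums and wreath products *)

Lemma multiplicative_of (K G : groupType) (f : K -> G) :
  {morph f : x y / x * y} -> exists F : {multiplicative K -> G}, F =1 f.
Proof.
move=> fM; pose fI := isMultiplicative.Build K G f fM.
pose F : {multiplicative K -> G} := HB.pack f fI.
by exists F.
Qed.

Section DirsumEmbedding.
Variables (R : realType) (I : choiceType) (K : I -> groupType).
Variable phi : forall i, {multiplicative K i -> PLo R}.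
Hypothesis phi_disjoint : forall i j k l x,
  i <> j -> phi i k x <> x -> phi j l x = x.
Implicit Types (u v : dirsum K) (m n : PLo R) (x : I01 R).

(** [m] is the product of the commuting elements [phi i (u i)], described by its
    action: it agrees with [phi i (u i)] on the support of the image of [phi i],
    and is trivial off these supports. *)
Definition acts_as u m := (forall i k x, phi i k x <> x -> m x = phi i (u i) x) /\
  (forall x, (forall i k, phi i k x = x) -> m x = x).

Let phi_moved i k l x : phi i k x <> x ->
  exists k', phi i k' (phi i l x) <> phi i l x.
Proof.
move=> kx; have [lx|lx] := pselect (phi i l x = x); first by exists k; rewrite lx.
by exists l^-1; rewrite multiplicativeV PLoK => xl; apply: lx; rewrite -xl.
Qed.

Let acts_exists (H : set (PLo R)) u : subgroup H -> (forall i k, H (phi i k)) ->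
  exists2 m, H m & acts_as u m.
Proof.
move=> /subgroupP[H1 HM _] Hphi.
have [s sE] : exists s : seq I, forall i, i \notin s -> u i = 1.
  have /finite_seqP[s sE] := dirsum_finite u; exists s => i.
  move=> /negP is_; apply: contrapT => ui; apply: is_.
  by have : [set i | u i <> 1] i by []; rewrite sE.
suff [m [Hm m1 m2]] : exists m, [/\ H m,
    forall i k x, i \in s -> phi i k x <> x -> m x = phi i (u i) x &
    forall x, (forall i k, i \in s -> phi i k x = x) -> m x = x].
  exists m => //; split=> [i k x kx|x fx]; last by apply: m2 => i k _.
  have [is_|nis] := boolP (i \in s); first exact: m1 kx.
  rewrite sE// multiplicative1 m2// => j l js; apply: phi_disjoint kx => ij.
  by rewrite ij js in nis.
elim: s {sE} => [|i s [m [Hm m1 m2]]]; first by exists 1.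
have [is_|nis] := boolP (i \in s).
  exists m; split=> // [j k x|x fx].
    by rewrite inE => /predU1P[ji|]; [apply: m1; rewrite ji|exact: m1].
  by apply: m2 => j k js; apply: fx; rewrite inE js orbT.
exists (phi i (u i) * m); split=> [|j k x jis kx|x fx] /=.
- exact: HM.
- have [ji|js] : j = i \/ j \in s by apply/predU1P; rewrite -in_cons.
    subst j; rewrite m2// => j l js; apply: phi_disjoint kx => ij.
    by rewrite ij js in nis.
  rewrite (m1 _ _ _ js kx); have ji : j <> i by move=> ji; rewrite -ji js in nis.
  by have [k'] := phi_moved (u j) kx; exact: phi_disjoint.
- rewrite m2 => [|j k js]; first by rewrite fx// inE eqxx.
  by rewrite fx// inE js orbT.
Qed.

Let acts_unique u m n : acts_as u m -> acts_as u n -> m = n.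
Proof.
move=> [m1 m2] [n1 n2]; apply: PLoP => x.
have [fx|/existsNP[i /existsNP[k kx]]] := pselect (forall i k, phi i k x = x).
  by rewrite m2// n2.
by rewrite (m1 _ _ _ kx) (n1 _ _ _ kx).
Qed.

(** Homomorphisms with pairwise disjoint supports extend to the direct sum. *)
Lemma dirsum_embedding : exists Phi : {multiplicative dirsum K -> PLo R},
  [/\ forall u m, m = Phi u <-> acts_as u m,
      (forall i, injective (phi i)) -> injective Phi &
      forall H, subgroup H -> (forall i k, H (phi i k)) -> forall u, H (Phi u)].
Proof.
have /choice[F Facts] : forall u, exists m, acts_as u m.
  move=> u; have [||m _ um] := @acts_exists setT u => //; first by apply/subgroupP.
  by exists m.
have FM : {morph F : u v / u * v}.
  move=> u v; apply: acts_unique (Facts _) _.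
  have [u1 u2] := Facts u; have [v1 v2] := Facts v; split=> [i k x kx|x fx] /=.
    rewrite (v1 _ _ _ kx) gmulfM /=.
    by have [k' /u1] := phi_moved (v i) kx.
  by rewrite v2// u2.
have [Phi PhiE] := multiplicative_of FM; exists Phi.
split=> [u m|phi_inj|H Hgrp Hphi u]; rewrite ?PhiE.
- by split=> [->|um]; [exact: Facts|exact: acts_unique um (Facts u)].
- apply: multiplicative_inj => u; rewrite PhiE => Fu.
  apply: dirsumP => i; apply: phi_inj; rewrite multiplicative1.
  apply: PLoP => x; apply: contrapT => ux.
  by have [/(_ _ _ _ ux) + _] := Facts u; rewrite Fu => xu; apply: ux.
- have [m Hm um] := acts_exists u Hgrp Hphi.
  by rewrite (acts_unique (Facts u) um).
Qed.

End DirsumEmbedding.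

Section IntegerPowers.
Variable G : groupType.
Implicit Types (h : G) (n : int).

(** Integer powers in a group, as a function on the infinite cyclic group. *)
Definition zpow h n : G := match n with
  | Posz m => h ^+ m
  | Negz m => h ^- m.+1
  end.

Lemma zpowS h n : zpow h (n + 1)%R = zpow h n * h.
Proof.
case: n => [n|[|n]].
- by rewrite -PoszD addn1 /= expgSr.
- by rewrite /= expg1 mulVg.
- rewrite (_ : (Negz n.+1 + 1)%R = Negz n); last by rewrite !NegzE; lia.
  by rewrite /= [h ^+ n.+2]expgS invgM mulgVK.
Qed.

Lemma zpowD h : {morph (zpow h : Zmult -> G) : m n / m * n}.
Proof.
have zD (m n : int) : zpow h (m + n)%R = zpow h m * zpow h n.
  elim/int_rect: n => [|n IHn|n IHn].
  - by rewrite addr0 /= mulg1.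
  - by rewrite intS [(1 + _)%R]addrC addrA !zpowS IHn mulgA.
  - apply: (mulIg h); rewrite -mulgA -!zpowS.
    have -> : (m - n.+1%:Z + 1 = m - n%:Z)%R by lia.
    by have -> : (- n.+1%:Z + 1 = - n%:Z)%R by lia.
exact: zD.
Qed.

End IntegerPowers.

Lemma PLo_expgE (R : realType) (h : PLo R) n x : (h ^+ n) x = iter n h x.
Proof. by elim: n => // n IHn; rewrite expgS /= IHn. Qed.

(** If the nonempty set [D] contains the support of the image of [f], and [h] and
    its powers move [D] off itself, then the conjugates of [f] by the powers of
    [h] commute with each other, and together with [h] they generate a wreath
    product. *)
Lemma wreath_embedding (R : realType) (K : groupType)
    (f : {multiplicative K -> PLo R}) (h : PLo R) (D : set (I01 R)) :
  injective f -> D !=set0 -> (forall k x, f k x <> x -> D x) ->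
  (forall n x, D x -> ~ D (iter n.+1 h x)) ->
  exists F : {multiplicative wreath K Zmult -> PLo R}, injective F /\
    forall H, subgroup H -> H h -> (forall k, H (f k)) -> forall w, H (F w).
Proof.
move=> finj [x0 Dx0] fD hD.
pose z : Zmult -> PLo R := zpow h.
have zM s t : z (s * t) = z s * z t by exact: zpowD.
have [Z ZE] := multiplicative_of zM.
have z1 : z 1 = 1 by [].
have zV s : z s^-1 = (z s)^-1 by rewrite -!ZE multiplicativeV.
have zD s x : D x -> D (z s x) -> s = 1.
  case: s => [[|n]|n] // Dx; rewrite /z /zpow.
    by rewrite PLo_expgE => /(hD n _ Dx).
  by move=> /(hD n); rewrite -PLo_expgE PLoVK => /(_ Dx).
have /choice[phi phiE] : forall s : Zmult, exists p : {multiplicative K -> PLo R},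
    p =1 (fun k => f k ^ z s).
  by move=> s; apply: multiplicative_of => k l; rewrite gmulfM conjMg.
have phiD s k x : phi s k x <> x -> D (z s x).
  rewrite phiE /= => kx; apply: (fD k) => fx; apply: kx.
  by rewrite fx PLoK.
have phi_disj s t k l x : s <> t -> phi s k x <> x -> phi t l x = x.
  move=> st /phiD Ds; apply: contrapT => /phiD Dt; apply: st.
  have : z (t * s^-1) (z s x) = z t x by rewrite zM zV /= PLoK.
  by move=> zst; apply/esym/divg1_eq/(zD _ _ Ds); rewrite zst.
have [Phi [PhiP Phi_inj PhiH]] := dirsum_embedding phi_disj.
have phiJ s t k y : phi (s * t) k y = (z t)^-1 (phi s k (z t y)).
  by rewrite !phiE zM conjgM.
(* Both sides act in the same way on the support of each phi s, which z t maps
   from the support of phi (s * t). *)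
have shiftE t b : Phi (shift t b) * z t = z t * Phi b.
  apply: (mulIg (z t)^-1); rewrite mulgK; apply/esym/PhiP.
  have [b1 b2] := (PhiP b (Phi b)).1 erefl.
  split=> [s k x kx|x fx] /=.
    rewrite (b1 (s * t) k); first by rewrite phiJ !PLoVK.
    by rewrite phiJ PLoVK => /(congr1 (z t)); rewrite !PLoVK.
  rewrite b2 ?PLoVK// => s k; rewrite -[s](mulgVK t) phiJ PLoVK fx//.
have FM : {morph (fun w : wreath K Zmult => Phi (wr_base w) * z (wr_top w)) :
    x y / x * y}.
  move=> x y /=; rewrite gmulfM zM -!mulgA; congr (_ * _).
  by rewrite !mulgA shiftE.
have [F FE] := multiplicative_of FM; exists F; split=> [|H Hgrp Hh Hf w].
  apply: multiplicative_inj => -[b t]; rewrite FE /= => bt1.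
  have [b1 b2] := (PhiP b (Phi b)).1 erefl.
  have btx x : Phi b (z t x) = x by rewrite -[RHS]/((1 : PLo R) x) -bt1.
  (* The point z t x0 lies in D as x0 does, so that t = 1. Indeed Phi b maps it
     to x0. If no phi s moves it, it equals x0. Otherwise both points lie in the
     support of the same phi s, and s = 1 because x0 lies in D. *)
  have t1 : t = 1.
    have Dt : (forall s k, phi s k (z t x0) = z t x0) \/ D (z t x0).
      have [|/existsNP[s /existsNP[k kx]]] :=
        pselect (forall s k, phi s k (z t x0) = z t x0); first by left.
      right; have := b1 _ _ _ kx; rewrite btx => x0E.
      have Ds := phiD _ _ _ kx; suff s1 : s = 1 by move: Ds; rewrite s1.
      apply: (zD _ x0 Dx0); have [kb|kb] := pselect (phi s (b s) (z t x0) = z t x0).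
        by rewrite x0E kb.
      apply: (phiD s (b s)^-1); rewrite multiplicativeV {1}x0E PLoK => E.
      by apply: kb; rewrite -x0E E.
    apply: (zD _ x0 Dx0); case: Dt => // /b2; rewrite btx => {1}<-.
    exact: Dx0.
  rewrite t1; apply: wreathP => // s /=; move: bt1; rewrite t1 z1 mulg1 => b11.
  suff -> : b = 1 by [].
  apply: Phi_inj; last by rewrite multiplicative1.
  by move=> s' k l; rewrite !phiE => /conjg_inj/finj.
have /subgroupP[H1 HM HV] := Hgrp.
have Hz s : H (z s).
  have HX n : H (h ^+ n) by elim: n => // n IHn; rewrite expgS; exact: HM.
  by case: s => n; [exact: HX|exact/HV/HX].
rewrite FE; apply: (HM _ _ _ (Hz _)); apply: PhiH => // s k; rewrite phiE.
by apply: (HM _ _ (HV _ (Hz s))); exact: HM.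
Qed.

(** * Embedding W in a non-solvable group *)

Section NonSolvable.
Variable R : realType.
Implicit Types (H : set (PLo R)) (T : seq (PLo R)) (x : I01 R).

Lemma moved_generated (A : set (PLo R)) g x :
  generated A g -> g x <> x -> moved A x.
Proof.
move=> Ag gx; apply: contrapT => nx; apply: gx.
suff : generated A `<=` [set g | g x = x] by apply.
apply: generated_sub => [|k Ak /=]; last first.
  by apply: contrapT => kx; apply: nx; exists k.
apply/subgroupP; split=> [//|k l /= kx lx|k /= kx]; first by rewrite lx.
by rewrite -{1}kx PLoK.
Qed.

(** Every non-solvable group contains each [W_ n], in a finitely generated
    subgroup; the induction on [n] passes to the derived subgroup of [H]. *)
Lemma W_embeds_fg n H : subgroup H -> ~ solvable H -> exists T : seq (PLo R),
  [/\ [set` T] `<=` H, moved [set` T] !=set0 &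
      embeds (W_ n) (generated [set` T])].
Proof.
elim: n H => [|n IHn] H Hgrp Hns.
  have [t Ht t1] := @iter_derived_neq1 _ 0 H Hgrp Hns.
  exists [:: t]; split=> [g /=||].
  - by rewrite inE => /eqP ->.
  - apply: contrapT => t0; apply: t1; apply: PLoP => x.
    apply: contrapT => tx; apply: t0; exists x, t => //=.
    by rewrite inE.
  have [|F FE] := @multiplicative_of unit (PLo R) (fun=> 1).
    by move=> x y; rewrite mulg1.
  exists F; split=> [[] []//|k]; rewrite FE.
  by have /subgroupP[] := generated_subgroup [set` [:: t]].
have Hns' : ~ solvable (derived H) by move/solvable_derived.
have [T [TH [x0 x0T] [f [finj fT]]]] := IHn _ (derived_subgroup H) Hns'.
have [S SH TS] := derived_finite TH.
have [h Sh hT] := wandering (generated_subgroup _) TS.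
have fD k x : f k x <> x -> moved [set` T] x by exact: moved_generated.
have [|F [Finj FH]] := wreath_embedding finj _ fD hT; first by exists x0.
exists (h :: T); split=> [g /=||].
- rewrite inE => /orP[/eqP ->|gT].
    by apply: generated_sub Sh.
  by apply: (derived_sub Hgrp); exact: TH.
- by case: x0T => g gT gx; exists x0, g => //; rewrite /= inE gT orbT.
exists F; split=> // w; apply: FH => [||k]; first exact: generated_subgroup.
  by apply: sub_generated; rewrite /= inE eqxx.
by apply: generated_mono (fT k) => g /=; rewrite inE => ->; rewrite orbT.
Qed.

(** A copy of [W_ n] can be split off, in such a way that the elements of [H]
    with support disjoint from it still form a non-solvable group: a finite
    subset of the derived subgroup of [H] witnessing that [W_ n] embeds and that
    the derived length is large can be moved off itself, and conjugating it
    gives elements of the new group. *)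
Lemma W_split n H : subgroup H -> ~ solvable H ->
  exists (f : {multiplicative W_ n -> PLo R}) H1,
  [/\ injective f, forall k, H (f k), subgroup H1 /\ ~ solvable H1,
      H1 `<=` H & forall k g x, H1 g -> f k x <> x -> g x = x].
Proof.
move=> Hgrp Hns; have /subgroupP[H1 HM HV] := Hgrp.
have Hns' : ~ solvable (derived H) by move/solvable_derived.
have [T [TH _ [f [finj fT]]]] := W_embeds_fg n (derived_subgroup H) Hns'.
pose C := [set g | H g /\ forall x, moved [set` T] x -> g x = x].
have Cgrp : subgroup C.
  apply/subgroupP; split=> [//|g k [Hg gx] [Hk kx]|g [Hg gx]].
    by split=> [|x xT /=]; [exact: HM|rewrite kx// gx].
  by split=> [|x xT]; [exact: HV|rewrite -{1}(gx x xT) PLoK].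
exists f, C; split=> //.
- by move=> k; apply: generated_sub (fT k) => // g /TH; exact: derived_sub.
- split=> // -[m Cm].
  have [z Dz z1] := iter_derived_neq1 m (derived_subgroup H) Hns'.
  have [L LH Lz] := iter_derived_finite Dz.
  have TLH : [set` T ++ L] `<=` derived H.
    by move=> g /=; rewrite mem_cat => /orP[/TH|/LH].
  have [S SH TLS] := derived_finite TLH.
  have [h Sh hTL] := wandering (generated_subgroup _) TLS.
  have Hh : H h by apply: generated_sub Sh.
  have [J JE] : exists J : {multiplicative PLo R -> PLo R},
      J =1 (fun g => g ^ h^-1).
    by apply: multiplicative_of => g k; rewrite conjMg.
  have JC : generated [set` L] `<=` [set g | C (J g)].
    apply: generated_sub => [|l lL /=].
      have /subgroupP[C1 CM CV] := Cgrp.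
      apply/subgroupP; split=> [|g k|g] /=.
      - by rewrite multiplicative1.
      - by rewrite gmulfM; exact: CM.
      - by rewrite multiplicativeV; exact: CV.
    rewrite JE; split=> [|x xT].
      have Hl : H l by apply: (derived_sub Hgrp); exact: LH.
      by rewrite /conjg invgK; apply: (HM) => //; apply: (HM) => //; exact: HV.
    rewrite /conjg invgK /=; suff -> : l (h^-1 x) = h^-1 x by rewrite PLoVK.
    apply: contrapT => lx; apply: (hTL 0 (h^-1 x)).
      by exists l => //=; rewrite mem_cat lL orbT.
    rewrite /= PLoVK; case: xT => g gT gx; exists g => //=.
    by rewrite mem_cat gT.
  have := iter_derived_morph JC Lz; rewrite Cm /= => Jz; apply: z1.
  by move: Jz; rewrite JE => /eqP; rewrite conjg_eq1 => /eqP.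
- by move=> g [].
- by move=> k g x [_ gx] fx; apply: gx; exact: moved_generated fx.
Qed.

Lemma not_solvable_embeds_W H : subgroup H -> ~ solvable H -> embeds W H.
Proof.
move=> Hgrp Hns; pose S := {H : set (PLo R) | subgroup H /\ ~ solvable H}.
have splitS n (K : S) : exists q : {multiplicative W_ n -> PLo R} * S,
    [/\ injective q.1, forall k, sval K (q.1 k), sval q.2 `<=` sval K &
        forall k g x, sval q.2 g -> q.1 k x <> x -> g x = x].
  case: K => K [Kgrp Kns] /=.
  by have [f [C [finj fK CP CK fC]]] := W_split n Kgrp Kns; exists (f, exist _ C CP).
pose split n K := sval (cid (splitS n K)).
(* Stage n + 1 consists of elements of stage n with support disjoint from that of
   the copy of W_ n found in stage n. *)
pose stage := nat_rect (fun=> S) (exist _ H (conj Hgrp Hns))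
  (fun n K => (split n K).2).
pose phi n := (split n (stage n)).1.
have stageS n : [/\ injective (phi n), forall k, sval (stage n) (phi n k),
    sval (stage n.+1) `<=` sval (stage n) &
    forall k g x, sval (stage n.+1) g -> phi n k x <> x -> g x = x].
  exact: (svalP (cid (splitS n (stage n)))).
have stage_le n m : (n <= m)%N -> sval (stage m) `<=` sval (stage n).
  move=> /subnK <-; elim: (m - n)%N => // d IHd g.
  by rewrite addSn; have [_ _ + _] := stageS (d + n)%N => /[apply]/IHd.
have phi_stage i j l : (i < j)%N -> sval (stage i.+1) (phi j l).
  by move=> ij; apply: (stage_le _ _ ij); have [] := stageS j.
have phi_disj i j k l x : i <> j -> phi i k x <> x -> phi j l x = x.
  move=> /eqP; rewrite neq_ltn => /orP[ij|ji] kx.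
    by have [_ _ _] := stageS i; apply; [exact: phi_stage ij|exact: kx].
  apply: contrapT => lx; apply: kx.
  by have [_ _ _] := stageS j; apply; [exact: phi_stage ji|exact: lx].
have [Phi [_ Phi_inj PhiH]] := dirsum_embedding phi_disj.
exists Phi; split=> [|k]; first by apply: Phi_inj => i; have [] := stageS i.
apply: PhiH => // i {}k; have [_ + _ _] := stageS i => /(_ k).
exact: (stage_le 0 i).
Qed.

End NonSolvable.

Theorem theorem1p1 (R : realType) (H : set (PLo R)) (Hsub : subgroup H) :
  ~ solvable H <-> embeds W H.
Proof.
split; first exact: not_solvable_embeds_W.
exact: embeds_W_not_solvable.
Qed.
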